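(* Let $n\ge 1$ and let $\mathbb{P}$ be a triangle-free graph on the vertex set $[n]$. Then: (i) $\mathrm{ex}_{\mathbb{P}}(n,K_3)\le \dfrac{n\,\alpha(\mathbb{P})}{2}$. (ii) If $e(\mathbb{P})+\mathrm{N}(S_2,\mathbb{P})<\lfloor n^2/4\rfloor$, then \[ \mathrm{ex}_{\mathbb{P}}(n,K_3)\ \ge\ \Big(\lfloor n^2/4\rfloor - e(\mathbb{P})-\mathrm{N}(S_2,\mathbb{P})\Big)\cdot \psi\big(\gamma(\mathbb{P})\, d(\mathbb{P})\big). \]
   Context: Graphs are identified with their edge sets; $e(G)$ is the number of edges. For a triangle-free graph $\mathbb{P}$ on $[n]$, $\mathrm{ex}_{\mathbb{P}}(n,K_3)$ denotes the maximum of $e(G)$ over all triangle-free graphs $G$ on $[n]$ with $\mathbb{P}\subseteq G$. $\alpha(\mathbb{P})$ is the independence number, $d(\mathbb{P})=2e(\mathbb{P})/n$ is the average degree, and $\mathrm{N}(S_2,\mathbb{P})=\sum_{v}\binom{d_{\mathbb{P}}(v)}{2}$ is the number of copies of the two-edge path (star with two edges) in $\mathbb{P}$. When $e(\mathbb{P})+\mathrm{N}(S_2,\mathbb{P})<\lfloor n^2/4\rfloor$, define $\gamma(\mathbb{P})=\dfrac{n(n-2)}{\lfloor n^2/4\rfloor-e(\mathbb{P})-\mathrm{N}(S_2,\mathbb{P})}$. The function $\psi:[0,\infty)\to(0,1]$ is defined by $\psi(d)=\dfrac{d\ln d-d+1}{(d-1)^2}$ for $d\notin\{0,1\}$, $\psi(0)=1$,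 $\psi(1)=1/2$ (it is continuous and decreasing). *)

(* Defs.v *)
From HB Require Import structures.
From mathcomp Require Import all_boot all_order all_algebra.
From mathcomp Require Import all_classical all_reals all_analysis.
Set Implicit Arguments. Unset Strict Implicit. Unset Printing Implicit Defensive.
Import Order.TTheory GRing.Theory Num.Theory.

(* A graph on vertex set [n] = 'I_n is identified with its edge set:
   a set of 2-element subsets of 'I_n. *)
Definition is_graph (n : nat) (G : {set {set 'I_n}}) : bool :=
  [forall e in G, #|e| == 2].

Definition triangle_free (n : nat) (G : {set {set 'I_n}}) : bool :=
  [forall a : 'I_n, forall b : 'I_n, forall c : 'I_n,
     ~~ [&& [set a; b] \in G, [set b; c] \in G & [set a; c] \in G]].

Definition nedges (n : nat) (G : {set {set 'I_n}}) : nat := #|G|.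

Definition deg (n : nat) (G : {set {set 'I_n}}) (v : 'I_n) : nat :=
  #|[set u : 'I_n | [set u; v] \in G]|.

Definition NS2 (n : nat) (G : {set {set 'I_n}}) : nat :=
  \sum_(v : 'I_n) 'C(deg G v, 2).

Definition independent (n : nat) (G : {set {set 'I_n}}) (S : {set 'I_n}) : bool :=
  [forall u in S, forall v in S, [set u; v] \notin G].

Definition alpha (n : nat) (G : {set {set 'I_n}}) : nat :=
  \max_(S : {set 'I_n} | independent G S) #|S|.

Definition exP (n : nat) (P : {set {set 'I_n}}) : nat :=
  \max_(G : {set {set 'I_n}} | [&& is_graph G, triangle_free G & P \subset G])
     nedges G.

Local Open Scope ring_scope.

Definition avgdeg (R : realType) (n : nat) (P : {set {set 'I_n}}) : R :=
  (2 * (nedges P)%:R) / n%:R.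

Definition gammaP (R : realType) (n : nat) (P : {set {set 'I_n}}) : R :=
  (n%:R * (n%:R - 2)) /
  ((n ^ 2 %/ 4)%N%:R - (nedges P)%:R - (NS2 P)%:R).

Definition psi (R : realType) (d : R) : R :=
  if d == 0 then 1
  else if d == 1 then 1 / 2
  else (d * ln d - d + 1) / (d - 1) ^+ 2.

(* Main.v *)
(* (i) In a triangle-free supergraph of P every neighbourhood is independent,
   also in P, so all degrees are at most alpha(P).

   (ii) Fix a bipartition of the vertices into parts A and B of sizes
   ceil(n/2), floor(n/2), and keep the pairs in A x B that are not the two ends
   of a two-edge path of P; at most N(S_2, P) pairs are lost. Join two such
   pairs when together they would form a triangle with an edge of P. This
   conflict graph, contained in the Cartesian product of P[A] and P[B], is
   triangle-free, and adding any of its independent sets to P keeps P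
   triangle-free. It has at most |B| e(P[A]) + |A| e(P[B]) <= (n - 2) e(P)
   edges, and Shearer's theorem (a triangle-free graph with N vertices and
   average degree d has an independent set of size N psi(d)) concludes, psi
   being decreasing. Convexity and monotonicity of psi are read off the
   integral of (1 - t) / (1 + (d - 1) t) over t in [0, 1], handled through
   antiderivatives. *)
Require Import Defs.
From HB Require Import structures.
From mathcomp Require Import all_boot all_order all_algebra.
From mathcomp Require Import all_classical all_reals all_analysis.
From mathcomp Require Import ring lra zify.
Import Order.TTheory GRing.Theory Num.Theory.
Local Open Scope ring_scope.

(** * Analysis of [psi]: sign, tangent lines, monotonicity *)

Lemma is_derive_le (R : realType) (f f' : R -> R) (a b : R) : a <= b ->
  (forall t, a <= t <= b -> is_derive t 1 f (f' t)) ->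
  (forall t, a < t < b -> 0 <= f' t) -> f a <= f b.
Proof.
rewrite le_eqVlt => /orP[/eqP-> //|ab] df f'0.
have [t t01 fab] : exists2 t, t \in `]a, b[%R & f b - f a = f' t * (b - a).
  apply: MVT => //.
    by move=> t; rewrite in_itv /= => /andP[/ltW ? /ltW ?]; apply: df; apply/andP.
  apply: derivable_within_continuous => t; rewrite in_itv /= => tab.
  exact: (@ex_derive _ _ _ _ _ _ _ (df t tab)).
by rewrite -subr_ge0 fab mulr_ge0 ?f'0 ?subr_ge0 ?(ltW ab).
Qed.

Lemma is_derive_affine (R : realType) (c t : R) :
  is_derive t 1 (cst 1 + cst c * id) c.
Proof. by apply: is_derive_eq => /=; rewrite /GRing.scale /=; ring. Qed.

(* [psi x] is the integral of [(1 - t) / (1 + (x - 1) * t)] over [[0, 1]]. The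
   product form of the last clause also covers the zero denominator at
   [x = 0], [t = 1]. *)
Lemma psi_antiderivative (R : realType) (x : R) : 0 <= x -> exists A a : R -> R,
  [/\ A 0 = 0, A 1 = psi x,
      forall t : R, 0 <= t <= 1 -> is_derive t 1 A (a t)
    & forall t : R, 0 <= t <= 1 -> a t * (1 + (x - 1) * t) = 1 - t].
Proof.
move=> x0; rewrite /psi; case: eqVneq => [->|xn0].
  exists id, (fun=> 1); split=> // [t _|t _]; first exact: is_derive_id.
  by ring.
case: eqVneq => [->|xn1].
  exists (id - cst (1 / 2) * id ^+ 2), (fun t => 1 - t); split=> [||t _|t _].
  - by rewrite !fctE /=; ring.
  - by rewrite !fctE /=; field.
  - by apply: is_derive_eq => /=; rewrite /GRing.scale /=; field.
  - by ring.
have xp : 0 < x by rewrite lt0r xn0.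
have c0 : x - 1 != 0 by rewrite subr_eq0.
exists (cst (x / (x - 1) ^+ 2) * (@ln R \o (cst 1 + cst (x - 1) * id))
        - cst (x - 1)^-1 * id).
exists (fun t => (1 - t) / (1 + (x - 1) * t)).
split=> [||t t01|t t01].
- by rewrite !fctE /= mulr0 addr0 ln1; ring.
- by rewrite !fctE /= mulr1 subrKC; field.
- have v0 : 0 < 1 + (x - 1) * t by nra.
  have dlv := @is_derive1_comp R _ (cst 1 + cst (x - 1) * id) t _ _
    (is_derive1_ln v0) (is_derive_affine _ (x - 1) t).
  apply: is_derive_eq => /=; rewrite /GRing.scale /=; field.
  by rewrite c0 lt0r_neq0.
- by rewrite divfK// lt0r_neq0//; nra.
Qed.

Lemma psi_ge0 (R : realType) (x : R) : 0 <= x -> 0 <= psi x.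
Proof.
move=> x0; have [A [a [A0 <- dA aE]]] := psi_antiderivative _ _ x0.
rewrite -{1}A0; apply: (is_derive_le _ _ _ _ _ ler01 dA) => t /andP[t0 t1].
have : a t * (1 + (x - 1) * t) = 1 - t by rewrite aE ?ltW.
have : 0 < 1 + (x - 1) * t by nra.
by nra.
Qed.

(* The tangent line at [d], its slope [g] being given by the differential
   equation [d (d - 1) psi' + (d + 1) psi = 1]. *)
Lemma psi_tangent (R : realType) (d : R) : 0 < d -> exists g : R,
  [/\ g <= 0, d * (d - 1) * g + (d + 1) * psi d = 1
    & forall x, 0 <= x -> psi d + g * (x - d) <= psi x].
Proof.
move=> d0; have [A [a [A0 A1 dA aE]]] := psi_antiderivative _ _ (ltW d0).
have vp (t : R) : 0 <= t <= 1 -> 0 < 1 + (d - 1) * t by nra.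
(* [B] integrates the derivative in [d] of (1 - t) / (1 + (d - 1) t), so [B 1] is the slope
   psi'(d). *)
have [B [B0 B1 dB]] : exists B : R -> R,
  [/\ B 0 = 0, d * (d - 1) * B 1 + (d + 1) * psi d = 1 & forall t : R,
     0 <= t <= 1 -> is_derive t 1 B (- (t * (1 - t)) / (1 + (d - 1) * t) ^+ 2)].
  have [->|dn1] := eqVneq d 1.
    exists (cst (1 / 3) * id ^+ 3 - cst (1 / 2) * id ^+ 2); split=> [||t _].
    - by rewrite !fctE /=; ring.
    - by rewrite /psi oner_eq0 eqxx; field.
    - by apply: is_derive_eq => /=; rewrite /GRing.scale /=; field.
  have c0 : d - 1 != 0 by rewrite subr_eq0.
  have dn0 := lt0r_neq0 d0.
  have [w [wE dw]] : exists w : R -> R, (forall t, w t = (1 + (d - 1) * t)^-1) /\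
      (forall t : R, 0 <= t <= 1 ->
         is_derive t 1 w (- (d - 1) / (1 + (d - 1) * t) ^+ 2)).
    exists (fun t => ((cst 1 + cst (d - 1) * id : R -> R) t)^-1); split=> // t t01.
    have := is_deriveV (f := cst 1 + cst (d - 1) * id : R -> R)
      (lt0r_neq0 (vp t t01)) (is_derive_affine _ (d - 1) t).
    by congr is_derive; rewrite /GRing.scale /= mulNr mulrC -mulNr.
  (* At t = 1, where [w] equals 1 / d, this primitive reduces to the differential equation solved
     for the slope. *)
  exists (cst (d * (d - 1))^-1 *
     ((cst (d + 1) * id - id ^+ 2) * w - cst (d + 1) * A)).
  split=> [||t t01].
  - by rewrite !fctE /= A0; ring.
  - by rewrite !fctE /= wE A1; field; rewrite subrKC dn0 c0.
  - have v0 := lt0r_neq0 (vp t t01).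
    have {}dw := dw t t01; have {}dA := dA t t01.
    rewrite -[a t](mulfK v0) aE// in dA.
    apply: is_derive_eq => /=; rewrite /GRing.scale !fctE /= wE; field.
    by rewrite ?v0 ?c0 ?dn0.
exists (B 1); split=> // [|x x0].
  rewrite -B0 -lerN2.
  have dNB (t : R) : 0 <= t <= 1 ->
      is_derive t 1 (- B) (t * (1 - t) / (1 + (d - 1) * t) ^+ 2).
    by move=> /dB ?; apply: is_derive_eq; rewrite mulNr opprK.
  have := is_derive_le _ _ _ _ _ ler01 dNB; rewrite !fctE /=; apply=> t /andP[t0 t1].
  by rewrite divr_ge0 ?exprn_ge0// ?mulr_ge0 ?subr_ge0 ?ltW ?vp ?ltW.
have [C [c [C0 C1 dC cE]]] := psi_antiderivative _ _ x0.
rewrite -A1 -C1 -subr_ge0.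
pose F : R -> R := C - A - cst (x - d) * B.
have dF (t : R) : 0 <= t <= 1 -> is_derive t 1 F
    (c t - a t + (x - d) * (t * (1 - t) / (1 + (d - 1) * t) ^+ 2)).
  move=> t01; have := dA t t01; have := dB t t01; have := dC t t01 => ? ? ?.
  by apply: is_derive_eq; rewrite /= /GRing.scale /=; ring.
have -> : C 1 - (A 1 + B 1 * (x - d)) = F 1 by rewrite /F !fctE /=; ring.
have <- : F 0 = 0 by rewrite /F !fctE /= C0 A0 B0; ring.
apply: (is_derive_le _ _ _ _ _ ler01 dF) => t /andP[t0 t1].
have t01 : 0 <= t <= 1 by rewrite !ltW.
have v0 : 0 < 1 + (d - 1) * t by nra.
have u0 : 0 < 1 + (x - 1) * t by nra.
have -> : a t = (1 - t) / (1 + (d - 1) * t).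
  by rewrite -(aE t t01) mulfK// lt0r_neq0.
have -> : c t = (1 - t) / (1 + (x - 1) * t).
  by rewrite -(cE t t01) mulfK// lt0r_neq0.
(* For fixed t the integrand is convex in [x]: its gap above the tangent at [d] is a square times
   nonnegative factors. *)
have -> : (1 - t) / (1 + (x - 1) * t) - (1 - t) / (1 + (d - 1) * t)
   + (x - d) * (t * (1 - t) / (1 + (d - 1) * t) ^+ 2)
   = (1 - t) * ((x - d) * t / (1 + (d - 1) * t)) ^+ 2 / (1 + (x - 1) * t).
  by field; rewrite !lt0r_neq0.
by apply: divr_ge0 (ltW u0); apply: mulr_ge0 (sqr_ge0 _); lra.
Qed.

(** The tangent is taken at the larger point [y], which is positive even when [x] is 0. *)
Lemma psi_decreasing (R : realType) (x y : R) :
  0 <= x -> x <= y -> psi y <= psi x.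
Proof.
move=> x0; rewrite le_eqVlt => /orP[/eqP-> //|xy].
have [g [g0 _ tg]] := psi_tangent _ _ (le_lt_trans x0 xy).
by apply: le_trans (tg x x0); rewrite lerDl mulr_le0 ?subr_le0 ?(ltW xy).
Qed.

(** * Shearer's theorem for triangle-free graphs *)

Section Shearer.
Variables (R : realType) (T : finType) (e : rel T).
Hypothesis esym : symmetric e.
Hypothesis etri : forall x y z, e x y -> e y z -> ~~ e x z.

Implicit Types S I : {set T}.

Definition nbhd S v := [set u in S | e v u].

Let N S v := S :\: (v |: nbhd S v).

Lemma trianglefree_irrefl x : e x x = false.
Proof. by apply/negP => h; have := etri _ _ _ h h; rewrite h. Qed.

Lemma card_delete_nbhd S v : v \in S -> #|S| = (1 + #|nbhd S v| + #|N S v|)%N.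
Proof.
move=> vS; rewrite /N -(cardsID (v |: nbhd S v) S) (finset.setIidPr _) ?cardsU1.
  by rewrite inE trianglefree_irrefl andbF.
by apply/fintype.subsetP => u; rewrite !inE => /predU1P[->//|/andP[]].
Qed.

Lemma sum_card_nbhd S S' : \sum_(x in S) #|nbhd S' x| =
  (\sum_x \sum_y [&& x \in S, y \in S' & e x y])%N.
Proof.
rewrite big_mkcond /=; apply: eq_bigr => x _.
case: (x \in S); last by rewrite big1.
by rewrite -sum1_card big_mkcond /=; apply: eq_bigr => y _; rewrite inE; case: ifP.
Qed.

(** Without triangles, no edge joins two neighbours of [v]. So an edge of [S] either survives in
    [N S v] or has exactly one end in [nbhd S v]; the identity is checked on each ordered pair. *)
Lemma degree_sum_delete_nbhd S v : v \in S ->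
  (\sum_(x in S) #|nbhd S x| =
   \sum_(x in N S v) #|nbhd (N S v) x| + 2 * \sum_(x in nbhd S v) #|nbhd S x|)%N.
Proof.
move=> vS; rewrite mul2n -addnn !sum_card_nbhd.
rewrite [X in (_ + (_ + X))%N]exchange_big /= -!big_split /=.
apply: eq_bigr => x _; rewrite -!big_split /=; apply: eq_bigr => y _.
rewrite !inE (esym y x); case exy: (e x y); last by rewrite !andbF.
case xS: (x \in S); case yS: (y \in S); rewrite ?andbF ?andbT //=.
have [xv|xv] := eqVneq x v; have [yv|yv] := eqVneq y v; subst=> //=.
- by rewrite trianglefree_irrefl in exy.
- by rewrite exy trianglefree_irrefl.
- by rewrite esym exy trianglefree_irrefl.
case vx: (e v x); case vy: (e v y) => //=.
by have := etri _ _ _ vx exy; rewrite vy.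
Qed.

(** After exchanging the sums, each vertex contributes its degree once per neighbour. *)
Lemma sum_deg_sqr S : \sum_(v in S) (\sum_(x in nbhd S v) #|nbhd S x|) =
  (\sum_(v in S) #|nbhd S v| ^ 2)%N.
Proof.
rewrite (exchange_big_dep (mem S)) /=; last by move=> v x _; rewrite inE => /andP[].
apply: eq_bigr => v vS; rewrite sum_nat_const; congr (_ * _)%N.
apply: eq_card => x; rewrite !inE; by rewrite unfold_in /= inE vS esym.
Qed.

Definition indep I := forall x y, x \in I -> y \in I -> ~~ e x y.

(* Deleting a vertex and its neighbourhood, the induction hypothesis and the
   tangent line at the average degree [d] give the bound [val v]; by the
   differential equation for [psi] and Cauchy-Schwarz for the degrees, the
   average of [val] over [S] is at least [#|S| * psi d]. *)
Lemma shearer S : exists I, [/\ I \subset S, indep I &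
  #|S|%:R * psi ((\sum_(v in S) #|nbhd S v|)%N%:R / #|S|%:R) <= #|I|%:R :> R].
Proof.
have [m] := ubnP #|S|; elim: m S => // m IH S; rewrite ltnS => cS.
set D := (\sum_(v in S) _)%N.
have [D0|] := posnP D.
  exists S; split=> //.
    move=> x y xS yS; apply/negP => exy.
    move/eqP: D0; rewrite sum_nat_eq0 => /forallP/(_ x); rewrite xS cards_eq0 /=.
    by move/eqP/setP/(_ y); rewrite !inE yS exy.
  by rewrite D0 mul0r /psi eqxx mulr1.
move=> D0; have S0 : (0 < #|S|)%N.
  by rewrite lt0n cards_eq0; apply/eqP => S0; move: D0; rewrite /D S0 big_set0.
set d : R := D%:R / #|S|%:R.
have d0 : 0 < d by rewrite divr_gt0 ?ltr0n.
have [g [g0 ode tg]] := psi_tangent _ _ d0.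
pose D' v := (\sum_(x in N S v) #|nbhd (N S v) x|)%N.
pose val v : R := 1 + #|N S v|%:R * psi d + g * ((D' v)%:R - #|N S v|%:R * d).
have [v vS vval] : exists2 v, v \in S & #|S|%:R * psi d <= val v.
  have Nd : #|S|%:R * d = D%:R by rewrite /d mulrC divfK// pnatr_eq0 -lt0n.
  have valE v : v \in S -> val v = (1 + (#|S|%:R - 1) * psi d + g * d)
      + (g * d - psi d) * #|nbhd S v|%:R
      - 2 * g * (\sum_(x in nbhd S v) #|nbhd S x|)%N%:R.
    move=> vS; have := degree_sum_delete_nbhd _ _ vS; have := card_delete_nbhd _ _ vS.
    rewrite -/D -/(D' v) mul2n -addnn.
    move=> /(congr1 (GRing.natmul (1 : R))) + /(congr1 (GRing.natmul (1 : R))).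
    rewrite !natrD /val => cE DE.
    have -> : #|N S v|%:R = #|S|%:R - 1 - #|nbhd S v|%:R :> R by rewrite cE; ring.
    have -> : (D' v)%:R = #|S|%:R * d
        - 2 * (\sum_(x in nbhd S v) #|nbhd S x|)%N%:R :> R by rewrite Nd DE; ring.
    by ring.
  have sumval : \sum_(v in S) (#|S|%:R * psi d) <= \sum_(v in S) val v.
    rewrite (eq_bigr _ valE) sumrB big_split /= -!mulr_sumr -!natr_sum sum_deg_sqr.
    have sumc (c : R) : \sum_(v in S) c = #|S|%:R * c by rewrite sumr_const mulr_natl.
    rewrite !sumc -/D -Nd.
    (* Cauchy-Schwarz, as nonnegativity of the variance of the degrees. *)
    have cs : #|S|%:R * d ^+ 2 <= (\sum_(v in S) #|nbhd S v| ^ 2)%N%:R :> R.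
      have : 0 <= \sum_(v in S) (#|nbhd S v|%:R - d) ^+ 2.
        by apply: sumr_ge0 => v _; exact: sqr_ge0.
      have sq (v : T) : (#|nbhd S v|%:R - d) ^+ 2
          = (#|nbhd S v| ^ 2)%N%:R - 2 * d * #|nbhd S v|%:R + d ^+ 2.
        by rewrite natrX; ring.
      rewrite (eq_bigr _ (fun v _ => sq v)).
      rewrite big_split /= sumrB -mulr_sumr -!natr_sum sumc -/D -Nd.
      lra.
    (* As [g <= 0], the term - 2 g q may be bounded below through [cs]; the differential equation
       then cancels everything except |S|^2 psi(d). *)
    have ode' := congr1 (fun z => #|S|%:R * z) ode; rewrite /= in ode'.
    rewrite -subr_le0 in cs; have := mulr_le0 g0 cs.
    by set q := (\sum_(v in S) _)%N%:R; set n := #|S|%:R in ode' *; nra.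
  apply/exists_inP; apply: contraLR sumval; rewrite negb_exists_in => /forall_inP nv.
  rewrite -ltNge; apply: ltr_sum => [|v /nv]; last by rewrite -ltNge.
  by move: S0; rewrite card_gt0 => /finset.set0Pn[v vS];
    apply/hasP; exists v => //; exact: mem_index_enum.
have cN := card_delete_nbhd _ _ vS.
have [|I [IN indI cI]] := IH (N S v); first by lia.
exists (v |: I); split.
- rewrite finset.subUset finset.sub1set vS; apply: fintype.subset_trans IN _.
  exact: finset.subsetDl.
- have vI y : y \in I -> ~~ e v y.
    by move=> /(fintype.subsetP IN); rewrite !inE negb_or => /andP[/andP[_ h] yS];
      rewrite yS in h.
  move=> x y /setU1P[->|xI] /setU1P[->|yI]; rewrite ?trianglefree_irrefl ?vI//.
    by rewrite esym vI.
  exact: indI.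
have vNI : v \notin I by apply/negP => /(fintype.subsetP IN); rewrite !inE eqxx.
rewrite cardsU1 vNI natrD; apply: le_trans vval _.
rewrite /val -addrA lerD2l; apply: le_trans cI.
(* The tangent inequality is scaled by the number of surviving vertices; if there are none, both
   sides vanish. *)
rewrite -/(D' v); have [N0|Npos] := posnP #|N S v|.
  rewrite N0 !mul0r add0r /D'.
  by move/eqP: N0; rewrite cards_eq0 => /eqP->; rewrite big_set0 subr0 mulr0.
have Npos' : 0 < #|N S v|%:R :> R by rewrite ltr0n.
have := tg ((D' v)%:R / #|N S v|%:R); rewrite divr_ge0// => /(_ isT).
rewrite -(ler_pM2l Npos'); apply: le_trans.
by rewrite le_eqVlt; apply/orP; left; apply/eqP; field; rewrite lt0r_neq0.
Qed.
End Shearer.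

Arguments nbhd {T} e S v.
Arguments indep {T} e I.

(** * Adjacency, degrees and the upper bound *)

Section Graphs.
Variable n : nat.
Implicit Types (P G : {set {set 'I_n}}) (A : {set 'I_n}).

Definition adj P : rel 'I_n := fun u v => [set u; v] \in P.

Lemma adj_sym P : symmetric (adj P).
Proof. by move=> u v; rewrite /adj finset.setUC. Qed.

Lemma adj_irrefl P u : is_graph P -> adj P u u = false.
Proof.
by move=> /forall_inP gP; apply/negP => /gP; rewrite finset.setUid cards1.
Qed.

Lemma adj_trianglefree P a b c :
  triangle_free P -> adj P a b -> adj P b c -> ~~ adj P a c.
Proof.
move=> /forallP/(_ a)/forallP/(_ b)/forallP/(_ c) + ab bc.
by rewrite /adj in ab bc *; rewrite ab bc.
Qed.

Lemma degE P v : deg P v = #|nbhd (adj P) [set: 'I_n] v|.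
Proof. by apply: eq_card => u; rewrite !inE adj_sym. Qed.

(** Without loops, u -> {u, v} is a bijection from the neighbours of [v] to the edges at [v]. *)
Lemma deg_edges P v : is_graph P -> deg P v = #|[set E in P | v \in E]|.
Proof.
move=> gP; rewrite /deg -(card_in_imset (f := fun u => [set u; v])).
  apply: eq_card => E; rewrite !inE; apply/imsetP/andP => [[u]|[EP]].
    by rewrite inE => uvP ->; rewrite !inE eqxx orbT.
  move: (EP) => /(forall_inP gP)/cards2P[x [y [_ EE]]].
  rewrite EE !inE => /orP[]/eqP vE.
    by exists y; rewrite ?inE vE finset.setUC -?EE.
  by exists x; rewrite ?inE vE -?EE.
move=> u u'; rewrite !inE => uP _ /setP/(_ u); rewrite !inE eqxx /=.
case: eqVneq => // _ /esym/eqP uv; move: uP; rewrite uv.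
by rewrite -/(adj P v v) adj_irrefl.
Qed.

Lemma handshake P : is_graph P -> (\sum_v deg P v = 2 * nedges P)%N.
Proof.
move=> gP; under eq_bigr do rewrite deg_edges// -sum1dep_card big_mkcondr /=.
rewrite exchange_big /= mulnC -sum_nat_const; apply: eq_bigr => E EP.
by rewrite -big_mkcond /= sum1_card; apply/eqP; exact: (forall_inP gP).
Qed.

Lemma exP_le P : (2 * exP P <= n * alpha P)%N.
Proof.
rewrite mul2n -geq_half_double; apply/bigmax_leqP => G /and3P[gG tG PG].
rewrite geq_half_double -mul2n -handshake//.
rewrite -[X in (_ <= X * _)%N]card_ord -sum_nat_const; apply: leq_sum => v _.
rewrite /alpha /deg; apply: leq_bigmax_cond.
apply/forall_inP => u; rewrite inE => uv; apply/forall_inP => w; rewrite inE => wv.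
apply/negP => /(fintype.subsetP PG) uw.
by have := adj_trianglefree _ _ _ _ tG uw wv; rewrite /adj uv.
Qed.
End Graphs.

Arguments adj {n} P.

(** * The conflict graph and its independent sets *)

Section ConflictGraph.
Variables (n : nat) (P : {set {set 'I_n}}) (A : {set 'I_n}).
Hypotheses (gP : is_graph P) (tP : triangle_free P).
Implicit Type I : {set 'I_n * 'I_n}.

(* Adding two pairs that share an endpoint, the other two endpoints being
   [P]-adjacent, would close a triangle with an edge of [P]. *)
Definition conflict : rel ('I_n * 'I_n) := fun p q =>
  (p.1 == q.1) && adj P p.2 q.2 || (p.2 == q.2) && adj P p.1 q.1.

Lemma conflict_sym : symmetric conflict.
Proof.
move=> p q; rewrite /conflict (adj_sym _ P p.1) (adj_sym _ P p.2).
by rewrite !(eq_sym q.1) !(eq_sym q.2).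
Qed.

(** If both conflicts fix the same coordinate, a third would give a triangle or a loop in [P]. If
    they fix different ones, [p] and [r] differ in both coordinates. *)
Lemma conflict_trianglefree p q r : conflict p q -> conflict q r -> ~~ conflict p r.
Proof.
case: p q r => [p1 p2] [q1 q2] [r1 r2]; rewrite /conflict /=.
move=> /orP[]/andP[/eqP<- pq] /orP[]/andP[/eqP<- qr].
- by rewrite (negPf (adj_trianglefree _ _ _ _ _ tP pq qr)) andbF;
    apply/negP => /andP[_]; rewrite adj_irrefl.
- apply/negP => /orP[]/andP[/eqP E]; first by move: qr; rewrite E adj_irrefl.
  by move: pq; rewrite E adj_irrefl.
- apply/negP => /orP[]/andP[/eqP E]; first by move: pq; rewrite E adj_irrefl.
  by move: qr; rewrite E adj_irrefl.
- by rewrite (negPf (adj_trianglefree _ _ _ _ _ tP pq qr)) andbF orbF;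
    apply/negP => /andP[_]; rewrite adj_irrefl.
Qed.

Definition safe_pairs := [set p : 'I_n * 'I_n | [&& p.1 \in A, p.2 \notin A &
  [forall w, ~~ (adj P p.1 w && adj P w p.2)]]].

(** A triangle in [P] plus the new edges is excluded according to its number of new edges: none, by
    [tP]; one, since safe pairs are not joined by a path of length two; two, by independence; three,
    since new edges all cross from [A] to its complement. *)
Lemma indep_conflict_le_exP I :
  I \subset safe_pairs -> indep conflict I -> (#|I| <= exP P)%N.
Proof.
move=> /fintype.subsetP IF indI.
have fst_in x y : (x, y) \in I -> x \in A by move=> /IF; rewrite !inE => /andP[].
have snd_in x y : (x, y) \in I -> y \in A = false.
  by move=> /IF; rewrite !inE => /and3P[_ /negPf].
have no_path x y w : (x, y) \in I -> adj P x w -> adj P w y -> False.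
  by move=> /IF; rewrite !inE => /and3P[_ _ /forallP/(_ w)/negP h] xw wy; apply: h; rewrite xw.
pose K := [set [set p.1; p.2] | p in I].
pose H x y := ((x, y) \in I) || ((y, x) \in I).
have Hsym x y : H x y = H y x by rewrite /H orbC.
have adjG x y : adj (P :|: K) x y = adj P x y || H x y.
  rewrite /adj inE; congr orb; apply/imsetP/orP => [[[u w] uwI /= E]|].
    have := set21 x y; have := set22 x y; rewrite E !inE => ey ex.
    have := set21 u w; have := set22 u w; rewrite -E !inE => ew eu.
    have := fst_in _ _ uwI; have := snd_in _ _ uwI.
    case/orP: ex => /eqP ?; case/orP: ey => /eqP ?; subst.
    - case/orP: ew => /eqP -> -> //.
    - by left.
    - by right.
    - case/orP: eu => /eqP -> -> //.
  by case=> xyI; [exists (x, y)|exists (y, x) => //=; rewrite finset.setUC].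
have Hcross x y : H x y -> (x \in A) = (y \notin A).
  by move=> /orP[]xy; rewrite (fst_in _ _ xy) (snd_in _ _ xy).
have Hpath x y w : H x y -> adj P x w -> adj P w y -> False.
  move=> /orP[]xy xw wy; first exact: no_path xy xw wy.
  by apply: no_path xy _ _; [rewrite adj_sym; exact: wy|rewrite adj_sym].
have Hconf x y z : H x y -> H x z -> adj P y z -> False.
  move=> /orP[]xy /orP[]xz yz.
  - by have /negP := indI _ _ xy xz; apply; rewrite /conflict eqxx yz.
  - by move: (snd_in _ _ xz); rewrite (fst_in _ _ xy).
  - by move: (snd_in _ _ xy); rewrite (fst_in _ _ xz).
  - by have /negP := indI _ _ xy xz; apply; rewrite /conflict eqxx yz orbT.
(* Membership in [A] orients each new edge, so forgetting the order of the pairs is injective on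
   [I]. *)
have <- : #|K| = #|I|.
  apply: card_in_imset => -[x y] [x' y'] xyI xyI' /= E.
  have := set21 x y; have := set22 x y; rewrite E !inE.
  have := fst_in _ _ xyI; have := snd_in _ _ xyI.
  have := fst_in _ _ xyI'; have := snd_in _ _ xyI'.
  move=> y'A x'A yA xA /orP[]/eqP ey /orP[]/eqP ex; subst=> //; congruence.
apply: leq_trans (subset_leq_card (finset.subsetUr P K)) _.
rewrite -/(nedges (P :|: K)) /exP; apply: leq_bigmax_cond.
rewrite finset.subsetUl andbT; apply/andP; split.
  apply/forall_inP => E; rewrite inE => /orP[/(forall_inP gP)//|/imsetP[[x y] xyI ->]].
  rewrite cards2 /=; case: (eqVneq x y) => // xy.
  by move: (fst_in _ _ xyI); rewrite xy (snd_in _ _ xyI).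
apply/forallP => a; apply/forallP => b; apply/forallP => c; apply/negP.
rewrite -!/(adj (P :|: K) _ _) !adjG => /and3P[ab bc ac].
case/orP: ab => ab; case/orP: bc => bc; case/orP: ac => ac.
- by have := adj_trianglefree _ _ _ _ _ tP ab bc; rewrite ac.
- exact: Hpath ac ab bc.
- by apply: (Hpath _ _ _ bc _ ac); rewrite adj_sym.
- by apply: (Hconf c a b) ab; rewrite Hsym.
- by apply: (Hpath _ _ _ ab ac); rewrite adj_sym.
- exact: Hconf ab ac bc.
- by apply: (Hconf b a c) ac; rewrite // Hsym.
- by move: (Hcross _ _ ab) (Hcross _ _ bc) (Hcross _ _ ac);
    case: (a \in A); case: (b \in A); case: (c \in A).
Qed.
End ConflictGraph.

Arguments conflict {n} P.
Arguments safe_pairs {n} P A.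

(** * Counting safe pairs and conflicts *)

Lemma leq_mul_bin2 k l : (k * l <= 'C(k + l, 2))%N.
Proof. by elim: k => // k IH; rewrite addSn binS bin1 mulSn addnC leq_add// leq_addl. Qed.

Section Counting.
Variables (n : nat) (P : {set {set 'I_n}}) (A : {set 'I_n}).
Hypotheses (gP : is_graph P).

(** A lost pair is joined through some middle vertex w. With k neighbours in [A] and l outside, w
    spoils at most k l pairs, which is at most the number of two-edge paths centred at w. *)
Lemma card_safe_pairs : (#|A| * #|~: A| <= #|safe_pairs P A| + NS2 P)%N.
Proof.
have sub : finset.setX A (~: A) \subset
    safe_pairs P A :|: \bigcup_w finset.setX (nbhd (adj P) A w) (nbhd (adj P) (~: A) w).
  apply/fintype.subsetP => -[x y]; rewrite !inE /= => /andP[xA yA]; rewrite xA yA /=.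
  case: forallP => //= h; apply/bigcupP.
  have /existsP[w] : [exists w, adj P x w && adj P w y].
    by apply: contra_notT h => /existsPn.
  by move=> /andP[xw wy]; exists w => //; rewrite !inE /= xA yA wy adj_sym xw.
rewrite -cardsX; apply: leq_trans (subset_leq_card sub) _.
apply: leq_trans (leq_card_setU _ _) _; rewrite leq_add2l.
have : (#|\bigcup_w finset.setX (nbhd (adj P) A w) (nbhd (adj P) (~: A) w)|
    <= \sum_w #|finset.setX (nbhd (adj P) A w) (nbhd (adj P) (~: A) w)|)%N.
  apply: (big_ind2 (fun (X : {set 'I_n * 'I_n}) k => #|X| <= k)%N) => [|X k Y l Xk Yl|//].
    by rewrite cards0.
  by apply: leq_trans (leq_card_setU _ _) _; exact: leq_add.
move=> /leq_trans; apply; apply: leq_sum => w _; rewrite cardsX.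
apply: leq_trans (leq_mul_bin2 _ _) _; rewrite degE -(cardsID A (nbhd (adj P) [set: 'I_n] w)).
have -> : nbhd (adj P) [set: 'I_n] w :&: A = nbhd (adj P) A w.
  by apply/setP => u; rewrite !inE andbC.
have -> // : nbhd (adj P) [set: 'I_n] w :\: A = nbhd (adj P) (~: A) w.
by apply/setP => u; rewrite !inE.
Qed.

(** A degree sum, hence twice the number of edges of [P] inside [B]. *)
Let inner (B : {set 'I_n}) := (\sum_(x in B) #|nbhd (adj P) B x|)%N.

Lemma inner_small (B : {set 'I_n}) : (#|B| <= 1)%N -> inner B = 0%N.
Proof.
move=> B1; apply: big1 => x xB; apply/eqP; rewrite cards_eq0 -finset.subset0.
apply/fintype.subsetP => y; rewrite !inE => /andP[yB].
by rewrite (card_le1_eqP B1 x y xB yB) adj_irrefl.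
Qed.

Lemma inner_sum_le : (inner A + inner (~: A) <= 2 * nedges P)%N.
Proof.
rewrite -handshake// (bigID (mem A)) /=; apply: leq_add.
  apply: leq_sum => x _; rewrite degE; apply: subset_leq_card.
  by apply/fintype.subsetP => y; rewrite !inE => /andP[].
under [X in (_ <= X)%N]eq_bigl => x do rewrite -finset.in_setC.
apply: leq_sum => x _; rewrite degE; apply: subset_leq_card.
by apply/fintype.subsetP => y; rewrite !inE => /andP[].
Qed.

(** A conflict keeps one coordinate and moves the other along an edge of [P] within its part.
    Summing over all of A x (complement of A) repeats each inner degree once per vertex of the
    opposite part. *)
Lemma degree_sum_conflict_le :
  (\sum_(p in safe_pairs P A) #|nbhd (conflict P) (safe_pairs P A) p|
   <= #|~: A| * inner A + #|A| * inner (~: A))%N.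
Proof.
have FX p : p \in safe_pairs P A -> p \in finset.setX A (~: A).
  by rewrite !inE => /and3P[-> ->].
have le p : p \in safe_pairs P A -> (#|nbhd (conflict P) (safe_pairs P A) p|
    <= #|nbhd (adj P) A p.1| + #|nbhd (adj P) (~: A) p.2|)%N.
  have -> : #|nbhd (adj P) A p.1| = #|finset.setX (nbhd (adj P) A p.1) [set p.2]|.
    by rewrite cardsX cards1 muln1.
  have -> : #|nbhd (adj P) (~: A) p.2| = #|finset.setX [set p.1] (nbhd (adj P) (~: A) p.2)|.
    by rewrite cardsX cards1 mul1n.
  move=> pF.
  apply: leq_trans (leq_card_setU _ _); apply: subset_leq_card.
  apply/fintype.subsetP => q; rewrite inE => /andP[/FX + ]; rewrite !inE => /andP[-> ->].
  by move=> /orP[]/andP[/eqP-> ->]; rewrite eqxx ?orbT.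
apply: leq_trans (_ : _ <= \sum_(p in safe_pairs P A)
  (#|nbhd (adj P) A p.1| + #|nbhd (adj P) (~: A) p.2|))%N _; first exact: leq_sum.
have sumX (F : 'I_n -> 'I_n -> nat) : (\sum_(p in finset.setX A (~: A)) F p.1 p.2
    = \sum_(x in A) \sum_(y in ~: A) F x y)%N.
  by rewrite pair_big_dep /=; apply: eq_bigl => p; rewrite inE.
have -> : (#|~: A| * inner A + #|A| * inner (~: A))%N =
    (\sum_(p in finset.setX A (~: A))
      (#|nbhd (adj P) A p.1| + #|nbhd (adj P) (~: A) p.2|))%N.
  rewrite (sumX (fun x y => #|nbhd (adj P) A x| + #|nbhd (adj P) (~: A) y|)%N).
  under eq_bigr do rewrite big_split /= sum_nat_const.
  by rewrite big_split /= -big_distrr sum_nat_const.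
rewrite [X in (_ <= X)%N](bigID (mem (safe_pairs P A))) /=; apply: leq_trans (leq_addr _ _).
apply/eq_leq/eq_bigl => p; rewrite andb_idl//; exact: FX.
Qed.
End Counting.

(** The target is D <= 2 k (n - 2), free of subtraction. For n >= 4 both halves are at most n - 2;
    smaller n are settled using [small] and the absence of edges inside parts with at most one
    vertex. *)
Lemma balanced_degree_sum n k l X Y D : (0 < n)%N -> (k + l < n ^ 2 %/ 4)%N ->
  (D <= n./2 * X + uphalf n * Y)%N -> (X + Y <= 2 * k)%N ->
  ((uphalf n <= 1)%N -> X = 0%N) -> ((n./2 <= 1)%N -> Y = 0%N) ->
  (D + 4 * k <= 2 * k * n)%N.
Proof.
move=> n0 small Dle sle s1 s2; have [n4|] := leqP 4 n.
  have h1 : (n./2 * X <= (n - 2) * X)%N by rewrite leq_mul2r; apply/orP; right; lia.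
  have h2 : (uphalf n * Y <= (n - 2) * Y)%N by rewrite leq_mul2r; apply/orP; right; lia.
  have : ((n - 2) * (X + Y) <= (n - 2) * (2 * k))%N by rewrite leq_mul2l sle orbT.
  by nia.
by case: n n0 small Dle sle s1 s2 => [|[|[|[|]]]] //=; lia.
Qed.

(** * Conclusion: both bounds *)

Theorem theorem1p1 (R : realType) (n : nat) (P : {set {set 'I_n}}) :
  (1 <= n)%N -> is_graph P -> triangle_free P ->
  ((exP P)%:R <= (n%:R * (alpha P)%:R) / 2 :> R) /\
  ((nedges P + NS2 P < n ^ 2 %/ 4)%N ->
   ((n ^ 2 %/ 4)%N%:R - (nedges P)%:R - (NS2 P)%:R)
     * psi (gammaP R P * avgdeg R P) <= ((exP P)%:R : R)).
Proof.
move=> n0 gP tP; split.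
  by rewrite ler_pdivlMr ?ltr0n// mulrC -!natrM ler_nat exP_le.
move=> small.
have [A cA] : exists A : {set 'I_n}, #|A| = uphalf n.
  have le_uphalf : (uphalf n <= n)%N by rewrite leq_uphalf_double -addnn leq_addr.
  exists [set widen_ord le_uphalf i | i : 'I_(uphalf n)].
  rewrite card_imset ?card_ord// => i j /(congr1 val) /= ij; exact: val_inj.
have cAC : #|~: A| = n./2.
  by have := cardsC A; rewrite cA card_ord; have := uphalf_half n;
    have := odd_double_half n; lia.
have [I [IF indI shI]] := shearer R _ _ (conflict_sym _ P)
  (conflict_trianglefree _ _ gP tP) (safe_pairs P A).
have IexP := indep_conflict_le_exP _ _ _ gP tP I IF indI.
set D := (\sum_(v in _) _)%N in shI; set M := #|safe_pairs P A| in shI.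
have cM : (n ^ 2 %/ 4 <= M + NS2 P)%N.
  apply: leq_trans (card_safe_pairs _ P A); rewrite cA cAC uphalf_half.
  rewrite -ltnS ltn_divLR// -{1}(odd_double_half n) -muln2 expnS expn1.
  by case: (odd n); nia.
have DM : (D + 4 * nedges P <= 2 * nedges P * n)%N.
  have Dle := degree_sum_conflict_le _ P A.
  have sle := inner_sum_le _ P A gP.
  have s1 := inner_small _ P gP A; have s2 := inner_small _ P gP (~: A).
  rewrite cA in Dle s1; rewrite cAC in Dle s2.
  exact: balanced_degree_sum small Dle sle s1 s2.
set m : R := (n ^ 2 %/ 4)%N%:R - (nedges P)%:R - (NS2 P)%:R.
have m0 : 0 < m by rewrite /m -addrA -opprD -natrD subr_gt0 ltr_nat.
have mM : m <= M%:R.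
  rewrite /m; move: cM; rewrite -(ler_nat R) natrD.
  by have : 0 <= (nedges P)%:R :> R by []; lra.
have M0 : 0 < M%:R :> R := lt_le_trans m0 mM.
(* The factor [gammaP] is scaled so that m * gamma * d is exactly 2 e(P) (n - 2), the bound on
   [D]. *)
have DM' : D%:R <= m * (gammaP R P * avgdeg R P).
  have -> : m * (gammaP R P * avgdeg R P) = 2 * (nedges P)%:R * n%:R - 4 * (nedges P)%:R.
    by rewrite /gammaP /avgdeg -/m; field; rewrite (lt0r_neq0 m0) pnatr_eq0 -lt0n n0.
  by rewrite lerBrDr -!natrM -natrD ler_nat.
have D0 : 0 <= gammaP R P * avgdeg R P by rewrite -(pmulr_rge0 _ m0); apply: le_trans DM'.
apply: le_trans (_ : M%:R * psi (D%:R / M%:R) <= _); last first.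
  by apply: le_trans shI _; rewrite ler_nat.
(* Both factors compare: m <= M, and D / M <= gamma * d because D <= m * gamma * d <= M * gamma *
   d. *)
apply: ler_pM => //; [exact: ltW|exact: psi_ge0|].
apply: psi_decreasing; first by rewrite divr_ge0.
rewrite ler_pdivrMr// mulrC; apply: le_trans DM' _.
by rewrite ler_wpM2r.
Qed.
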